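(* Let $a,b,c,d\in\mathbb{R}$ be such that the quartic equation $x^4+ax^3+bx^2+cx+d=0$ has four real roots (counted with multiplicity). Then the equation cannot have a root greater than $\lambda_{\max}=-\frac a4+\frac{\sqrt3}{4}\sqrt{3a^2-8b}$ and cannot have a root smaller than $\lambda_{\min}=-\frac a4-\frac{\sqrt3}{4}\sqrt{3a^2-8b}$. *)

(* Defs.v *)
From mathcomp Require Import all_boot all_order all_algebra.
From mathcomp Require Import reals.

Set Implicit Arguments.
Unset Strict Implicit.
Unset Printing Implicit Defensive.

Import Order.TTheory GRing.Theory Num.Theory.
Local Open Scope ring_scope.

Definition quartic (R : realType) (a b c d : R) : {poly R} :=
  'X^4 + a *: 'X^3 + b *: 'X^2 + c *: 'X + d%:P.

(* The sequence s lists the roots of p in R, each one repeated according to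
   its multiplicity mup x p (which is 0 when p != 0 and x is not a root). *)
Definition has_roots_with_mult (R : realType) (n : nat) (p : {poly R}) : Prop :=
  exists s : seq R, size s = n /\ forall x : R, count_mem x s = mup x p.

Definition lambda_max (R : realType) (a b : R) : R :=
  - (a / 4) + Num.sqrt 3 / 4 * Num.sqrt (3 * a ^+ 2 - 8 * b).

Definition lambda_min (R : realType) (a b : R) : R :=
  - (a / 4) - Num.sqrt 3 / 4 * Num.sqrt (3 * a ^+ 2 - 8 * b).

(* Main.v *)
Require Import Defs.
From mathcomp Require Import all_boot all_order all_algebra.
From mathcomp Require Import reals.
From mathcomp Require Import ring lra.
Import Order.TTheory GRing.Theory Num.Theory.
Local Open Scope ring_scope.

(** Let [x] be one root of the quartic and [y], [z], [t] the three others.  By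
    Vieta, [y + z + t = - a - x] and [y^2 + z^2 + t^2 = a^2 - 2 b - x^2]: the
    sum and the sum of squares of the three other roots depend on [x], [a] and
    [b] only.  Real numbers satisfy [(y + z + t)^2 <= 3 (y^2 + z^2 + t^2)]; read
    as a condition on [x], this is the quadratic inequality
    [(4 x + a)^2 <= 3 (3 a^2 - 8 b)] ([quartic_root_sqr_bound]), whose real
    solutions lie between [lambda_min] and [lambda_max].

    Vieta's formulas come from comparing coefficients in the factorisation of
    the quartic over its list of roots; that a list with the right
    multiplicities does yield a factorisation of a monic polynomial is
    [monic_eq_prod_XsubC_mup]. *)

(** Factors are split off one at a time: dividing by ['X - y%:P] lowers the
    multiplicity of [y] by one and leaves the others unchanged, just as removing
    [y] from the list does with its count. *)
Lemma dvdp_prod_XsubC_mup (F : fieldType) (s : seq F) (p : {poly F}) :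
  p != 0 -> (forall x, count_mem x s <= mup x p)%N ->
  \prod_(x <- s) ('X - x%:P) %| p.
Proof.
elim: s p => [|y s IHs] p p0 le_s_p; first by rewrite big_nil dvd1p.
have: 'X - y%:P %| p.
  by rewrite XsubC_dvd // (leq_trans _ (le_s_p y)) //= eqxx.
case/dvdpP => q def_p; rewrite def_p big_cons mulrC dvdp_mul2r ?polyXsubC_eq0 //.
have q0 : q != 0 by apply: contraNneq p0 => q0; rewrite def_p q0 mul0r.
apply: IHs => // x; have := le_s_p x.
rewrite def_p mupM ?polyXsubC_eq0 // (@mup_XsubCX _ 1) /= addnC.
by case: (y == x); rewrite ?addn0 // !addn1 ltnS.
Qed.

Lemma monic_eq_prod_XsubC_mup (F : fieldType) (s : seq F) (p : {poly F}) :
  p \is monic -> size p = (size s).+1 ->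
  (forall x, count_mem x s <= mup x p)%N ->
  p = \prod_(x <- s) ('X - x%:P).
Proof.
move=> p_monic size_p le_s_p; apply/esym/eqP.
rewrite -eqp_monic ?monic_prod_XsubC //.
by rewrite -dvdp_size_eqp ?size_prod_XsubC ?size_p //;
  apply: dvdp_prod_XsubC_mup; rewrite // monic_neq0.
Qed.

Lemma prod_XsubC4 (R : comNzRingType) (x y z t : R) :
  \prod_(u <- [:: x; y; z; t]) ('X - u%:P) =
  'X^4 - (x + y + z + t) *: 'X^3
  + (x * y + x * z + x * t + y * z + y * t + z * t) *: 'X^2
  - (x * y * z + x * y * t + x * z * t + y * z * t) *: 'X
  + (x * y * z * t)%:P :> {poly R}.
Proof. by rewrite !big_cons big_nil -!mul_polyC !(polyCD, polyCM); ring. Qed.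

Lemma quartic_monic_size (R : realType) (a b c d : R) :
  quartic a b c d \is monic /\ size (quartic a b c d) = 5%N.
Proof.
have -> : quartic a b c d = Poly [:: d; c; b; a; 1].
  by apply/polyP => i; rewrite /quartic !coefE; case: i => [|[|[|[|[|i]]]]] /=;
    rewrite ?mulr0 ?mulr1 ?addr0 ?add0r ?nth_nil.
by rewrite monicE lead_coefE (@PolyK _ 0) /= ?oner_eq0.
Qed.

Lemma quartic_vieta (R : realType) (a b c d x y z t : R) :
  quartic a b c d = \prod_(u <- [:: x; y; z; t]) ('X - u%:P) ->
  a = - (x + y + z + t) /\
  b = x * y + x * z + x * t + y * z + y * t + z * t.
Proof.
rewrite prod_XsubC4 => /polyP E; move: (E 3) (E 2).
by rewrite /quartic !coefE /= !(mulr0, mulr1, addr0, add0r, oppr0).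
Qed.

(** The difference of the two sides is four times
    [3 (y^2 + z^2 + t^2) - (y + z + t)^2], a sum of squares. *)
Lemma quartic_root_sqr_bound (R : realDomainType) (x y z t a b : R) :
  a = - (x + y + z + t) ->
  b = x * y + x * z + x * t + y * z + y * t + z * t ->
  (4 * x + a) ^+ 2 <= 3 * (3 * a ^+ 2 - 8 * b).
Proof.
move=> -> ->; rewrite -subr_ge0.
have -> : 3 * (3 * (- (x + y + z + t)) ^+ 2 -
  8 * (x * y + x * z + x * t + y * z + y * t + z * t)) -
  (4 * x + - (x + y + z + t)) ^+ 2 =
  4 * ((y - z) ^+ 2 + (y - t) ^+ 2 + (z - t) ^+ 2) :> R by ring.
by rewrite mulr_ge0 ?ler0n // !addr_ge0 ?sqr_ge0.
Qed.

Lemma quartic_root_between (R : realType) (a b c d x : R) :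
  has_roots_with_mult 4 (quartic a b c d) -> root (quartic a b c d) x ->
  lambda_min a b <= x <= lambda_max a b.
Proof.
move=> [s [size_s count_s]] px0.
have [p_monic size_p] := quartic_monic_size R a b c d.
have x_s : x \in s.
  by rewrite -has_pred1 has_count count_s -XsubC_dvd ?monic_neq0 // dvdp_XsubCl.
have def_p : quartic a b c d = \prod_(u <- x :: rem x s) ('X - u%:P).
  rewrite -(perm_big _ (perm_to_rem x_s)) /=; apply: monic_eq_prod_XsubC_mup => //.
    by rewrite size_p size_s.
  by move=> u; rewrite count_s.
have := size_rem x_s; rewrite size_s.
case: (rem x s) def_p => [|y [|z [|t [|]]]] // /quartic_vieta[Da Db] _.
have := quartic_root_sqr_bound _ _ _ _ _ _ _ Da Db.
move=> /ler_wsqrtr; rewrite sqrtr_sqr sqrtrM ?ler0n // ler_norml.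
rewrite /lambda_min /lambda_max mulrAC.
by move: (Num.sqrt 3 * _) => w /andP[lo hi]; apply/andP; split; lra.
Qed.

Theorem theorem9 (R : realType) (a b c d : R)
  (four_real_roots : has_roots_with_mult 4 (quartic a b c d)) :
  (~ exists x : R, root (quartic a b c d) x /\ x > lambda_max a b) /\
  (~ exists x : R, root (quartic a b c d) x /\ x < lambda_min a b).
Proof.
split=> -[x [/(quartic_root_between _ _ _ _ _ _ four_real_roots)/andP[le_min le_max]]].
  by rewrite ltNge le_max.
by rewrite ltNge le_min.
Qed.
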